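(* Let $\mathcal{P_O}=\langle S,O,A,r,p,\omega,\gamma,\mu\rangle$ be a POMDP with discount factor $\gamma\in[0,1)$, let $\mathcal{P}$ be a set of propositional symbols, let $L:O_\emptyset\times A_\emptyset\times O\to2^{\mathcal{P}}$ be a labelling function, and let $\mathcal{R}_{\mathcal{P}}=\langle U,u_0,\delta_u,\delta_r\rangle$ be a reward machine that is perfect for $\mathcal{P_O}$ with respect to $L$. Then any policy $\pi(a|o,u)$ that is optimal for $\mathcal{R}_{\mathcal{P}}$ with respect to the environmental reward is also optimal for $\mathcal{P_O}$.
   Context: **POMDP.** A POMDP is a tuple $\mathcal{P_O}=\langle S,O,A,r,p,\omega,\gamma,\mu\rangle$ where $S$ is a finite set of states, $O$ a finite set of observations, $A$ a finite set of actions, $r:S\times A\to\mathbb{R}$ the reward function, $p(s'|s,a)$ the transition probability distribution, $\omega(o|s)$ the observation probability distribution, $\gamma$ the discount factor, and $\mu$ the initial state distribution. The process evolves as follows: $s_0\sim\mu$; at each time $t$ the agent observes $o_t\sim\omega(\cdot|s_t)$ (but not $s_t$), executes $a_t\in A$, receives the immediate environmental reward $r_t=r(s_t,a_t)$, and the next state is drawn as $s_{t+1}\sim p(\cdot|s_t,a_t)$. A policy over $\mathcal{P_O}$ assigns to each history $(o_0,a_0,\ldots,a_{t-1},o_t)$ a probability distribution over $A$ from which $a_t$ is drawn. **Labelling function.** For a set $X$, write $X_\emptyset=X\cup\{\emptyset\}$. A labelling function is a map $L:O_\emptyset\times A_\emptyset\times O\to 2^{\mathcal{P}}$; it assigns to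 an experience $(o,a,o')$ (observing $o$, executing $a$, then observing $o'$) the set of symbols that are true, with $L(\emptyset,\emptyset,o)$ used for the initial observation. **Reward machine (RM).** Given $\mathcal{P}$, a reward machine is a tuple $\mathcal{R}_{\mathcal{P}}=\langle U,u_0,\delta_u,\delta_r\rangle$ where $U$ is a finite set of states, $u_0\in U$ is an initial state, $\delta_u:U\times 2^{\mathcal{P}}\to U$ is the state-transition function and $\delta_r:U\times 2^{\mathcal{P}}\to\mathbb{R}$ is the reward-transition function. Along a history, the RM state at time $t$ is $x_t$, where $x_0=u_0$ and $x_t=\delta_u(x_{t-1},L(o_{t-1},a_{t-1},o_t))$ for $t\ge1$. **Perfect RM.** $\mathcal{R}_{\mathcal{P}}$ is perfect for $\mathcal{P_O}$ with respect to $L$ iff for every trace $(o_0,a_0,\ldots,o_t,a_t)$ generated (with positive probability) by any policy over $\mathcal{P_O}$, $$\Pr(o_{t+1},r_t\mid o_0,a_0,\ldots,o_t,a_t)=\Pr(o_{t+1},r_t\mid o_t,x_t,a_t).$$ Here the right-hand side is understood as a time- and policy-independent kernel: there is a function $q(o',\rho\mid o,u,a)$ such that, for every such trace and every $(o',\rho)\in O\times\mathbb{R}$, $\Pr(o_{t+1}=o',r_t=\rho\mid o_0,a_0,\ldots,o_t,a_t)=q(o',\rho\mid o_t,x_t,a_t)$. That is, the environment is Markovian with respect to $O\times U$. **Optimality.** The value of a policy is its expected discounted environmental return $\mathbb{E}_{\pi}\left[\sum_{t\ge 0}\gamma^t r_t\right]$ with $s_0\sim\mu$ (the RM rewards $\delta_r$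 play no role). A policy for $\mathcal{R}_{\mathcal{P}}$ is a map $\pi(a|o,u)$ giving a distribution over $A$ for each $(o,u)\in O\times U$; it is executed in $\mathcal{P_O}$ by drawing $a_t\sim\pi(\cdot|o_t,x_t)$. It is optimal for $\mathcal{R}_{\mathcal{P}}$ with respect to the environmental reward if its value is maximal among all policies of this form. A policy is optimal for $\mathcal{P_O}$ if its value is maximal among all (history-dependent) policies over $\mathcal{P_O}$. *)

(* Defs.v *)
From HB Require Import structures.
From mathcomp Require Import all_boot all_order all_algebra.
From mathcomp Require Import all_classical all_reals all_analysis.

Set Implicit Arguments.
Unset Strict Implicit.
Unset Printing Implicit Defensive.

Import Order.TTheory GRing.Theory Num.Theory.
Import numFieldNormedType.Exports.

Local Open Scope classical_set_scope.
Local Open Scope ring_scope.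

Record fdist (R : realType) (T : finType) := Fdist {
  fdist_fun :> T -> R;
  fdist_ge0 : forall x, 0 <= fdist_fun x;
  fdist_sum1 : \sum_x fdist_fun x = 1 }.

Lemma fdist_inhabited (R : realType) (T : finType) (d : fdist R T) :
  exists x : T, True.
Proof.
case: (pickP (@predT T)) => [x _|T0]; first by exists x.
have /eqP := fdist_sum1 d.
by rewrite big_pred0 // eq_sym oner_eq0.
Qed.

Definition fdist_pick (R : realType) (T : finType) (d : fdist R T) : T :=
  projT1 (cid (fdist_inhabited d)).

(* The argument [x0] only witnesses that [T] is nonempty, as the library
   requires measurable types to be pointed. *)
Definition trajectory (T : finType) (x0 : T) : Type := nat -> T.

Definition coordinate_sets (T : finType) (x0 : T) : set (set (trajectory x0)) :=
  [set B | exists n x, B = [set w | w n = x]].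
Arguments coordinate_sets {T} x0 _.

Section trajectory_measurable.
Variables (T : finType) (x0 : T).

HB.instance Definition _ := gen_eqMixin (trajectory x0).
HB.instance Definition _ := gen_choiceMixin (trajectory x0).
HB.instance Definition _ := isPointed.Build (trajectory x0) (fun=> x0).

(* The product sigma-algebra. *)
HB.instance Definition _ := @isMeasurable.Build
  (sigma_display (coordinate_sets x0)) (trajectory x0)
  <<s coordinate_sets x0 >>
  (@sigma_algebra0 _ setT (coordinate_sets x0))
  (@sigma_algebraC _ (coordinate_sets x0))
  (@sigma_algebra_bigcup _ setT (coordinate_sets x0)).

End trajectory_measurable.

Section unit_mass.
Context d (T : measurableType d) (R : realType).
Variables (m : {measure set T -> \bar R}) (m1 : m setT = 1%E).

Let P : set T -> \bar R := m.

HB.instance Definition _ := Measure.on P.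
HB.instance Definition _ := @Measure_isProbability.Build d T R P m1.

Lemma unit_mass_probability : exists Q : probability T R, forall A, Q A = m A.
Proof. by exists P. Qed.

End unit_mass.

(* Existence of a probability on trajectories with prescribed cylinder
   probabilities: nested intervals of [0, 1[ of lengths [W s] code the finite
   prefixes [s], and the law is the image of the uniform law by the coding. *)
Section trajectory_extension.
Variables (R : realType) (T : finType) (x0 : T) (W : seq T -> R).
Hypothesis W0 : W [::] = 1.
Hypothesis W_ge0 : forall s, 0 <= W s.
Hypothesis W_rcons : forall s, \sum_x W (rcons s x) = W s.

Let F (s : seq T) (k : nat) : R :=
  \sum_(y | (enum_rank y < k)%N) W (rcons s y).

Let below (s : seq T) (x : T) : R := F s (enum_rank x).

Let lo (s : seq T) : R :=
  \sum_(i < size s) below (take i s) (nth x0 s i).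

Let cell (s : seq T) (u : R) : bool := (lo s <= u) && (u < lo s + W s).

Let dig (s : seq T) (u : R) : T :=
  if [pick x | cell (rcons s x) u] is Some x then x else x0.

Fixpoint traj_prefix (u : R) (n : nat) : seq T :=
  if n is m.+1 then rcons (traj_prefix u m) (dig (traj_prefix u m) u)
  else [::].
Let pre := traj_prefix.

Let f (u : R) : trajectory x0 := fun n => dig (pre u n) u.

Let size_pre u n : size (pre u n) = n.
Proof. by elim: n => //= n IH; rewrite size_rcons IH. Qed.

Let mkseq_f u n : mkseq (f u) n = pre u n.
Proof. by elim: n => //= n IH; rewrite mkseqS IH. Qed.

Let lo_rcons s x : lo (rcons s x) = lo s + below s x.
Proof.
rewrite /lo size_rcons big_ord_recr/=; congr (_ + _).
  apply: eq_bigr => i _; rewrite nth_rcons ltn_ord.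
  by rewrite -cats1 takel_cat // ltnW.
by rewrite -cats1 take_size_cat // nth_cat ltnn subnn.
Qed.

Let F0 s : F s 0 = 0.
Proof. by rewrite /F big_pred0. Qed.

Let Fmax s : F s #|T| = W s.
Proof.
by rewrite /F -W_rcons; apply: eq_bigl => y; rewrite ltn_ord.
Qed.

Let FS s (x : T) : F s (enum_rank x).+1 = F s (enum_rank x) + W (rcons s x).
Proof.
rewrite /F (bigD1 x) //= addrC; congr (_ + _).
apply: eq_bigl => y; rewrite ltnS ltn_neqAle andbC.
congr (_ && _).
by rewrite (inj_eq val_inj) (inj_eq enum_rank_inj).
Qed.

Let F_homo s (m n : nat) : (m <= n)%N -> F s m <= F s n.
Proof.
move=> mn; rewrite /F [leRHS](bigID (fun y => (enum_rank y < m)%N)) /=.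
rewrite (eq_bigl (fun y => (enum_rank y < n)%N && (enum_rank y < m)%N)).
  by rewrite lerDl sumr_ge0.
move=> y; apply/idP/andP => [ym|[]//]; split=> //; exact: leq_trans ym mn.
Qed.

Let cell_uniq s x y u : cell (rcons s x) u -> cell (rcons s y) u -> x = y.
Proof.
wlog xy : x y / (enum_rank x <= enum_rank y)%N.
  move=> H cx cy; case/orP: (leq_total (enum_rank x) (enum_rank y)) => h.
    exact: H.
  by apply/esym/H.
rewrite /cell !lo_rcons -!addrA /below -!FS => /andP[_ ux] /andP[uy _].
apply: enum_rank_inj; apply/val_inj/eqP; rewrite eqn_leq xy /= leqNgt.
apply/negP => /(@F_homo s) h.
have := lt_le_trans ux (le_trans _ uy); rewrite lerD2l => /(_ h).
by rewrite ltxx.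
Qed.

Let cell_ex s u : cell s u -> exists x, cell (rcons s x) u.
Proof.
move=> /andP[su us].
have ex : exists k, u < lo s + F s k by exists #|T|; rewrite Fmax.
case: (ex_minnP ex) => -[|k]; first by rewrite F0 addr0 ltNge su.
move=> uk kmin.
have kT : (k < #|T|)%N.
  by have := kmin #|T|; rewrite Fmax us; apply.
have [x xk] : exists x : T, enum_rank x = k :> nat.
  by exists (enum_val (Ordinal kT)); rewrite enum_valK.
exists x; rewrite /cell lo_rcons -addrA /below -FS xk uk andbT leNgt.
by apply/negP => /kmin; rewrite ltnn.
Qed.

Let cell_rcons s x u : cell (rcons s x) u -> cell s u.
Proof.
rewrite /cell lo_rcons -addrA /below -FS => /andP[h1 h2]; apply/andP; split.
  apply: le_trans h1; rewrite lerDl -(F0 s); exact: F_homo.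
apply: lt_le_trans h2 _; rewrite lerD2l -Fmax; exact: F_homo.
Qed.

Let digP s u : cell s u -> cell (rcons s (dig s u)) u.
Proof.
by move=> /cell_ex[x cx]; rewrite /dig; case: pickP => // /(_ x); rewrite cx.
Qed.

Let cell_nil u : cell [::] u = (0 <= u < 1).
Proof. by rewrite /cell /lo big_ord0 W0 add0r. Qed.

Let cell_pre u n : 0 <= u < 1 -> cell (pre u n) u.
Proof.
by move=> u01; elim: n => [|n IH] /=; [rewrite cell_nil|exact: digP].
Qed.

Let cell_01 s u : cell s u -> 0 <= u < 1.
Proof.
elim/last_ind: s => [|s x IH]; first by rewrite cell_nil.
by move=> /cell_rcons.
Qed.

Let pre_cell s u : cell s u -> pre u (size s) = s.
Proof.
elim/last_ind: s => // s x IH c; rewrite size_rcons /=.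
have cs := cell_rcons c; rewrite -/pre (IH cs); congr rcons.
exact: cell_uniq (digP cs) c.
Qed.

Let measurable_cell s : measurable [set u : measurableTypeR R | cell s u].
Proof.
rewrite (_ : [set u | _] = [set` `[lo s, lo s + W s[]).
  exact: measurable_itv.
by apply/seteqP; split => u /=; rewrite in_itv.
Qed.

Let f_out u : ~~ (0 <= u < 1) -> forall n, f u n = x0.
Proof.
move=> u01 n; rewrite /f /dig; case: pickP => // x /cell_01.
by rewrite (negbTE u01).
Qed.

Let measurable_f : measurable_fun [set: measurableTypeR R] f.
Proof.
apply: (measurability (coordinate_sets x0)) => //.
move=> _ [_ [n [x ->]] <-]; rewrite setTI.
pose I : set (measurableTypeR R) := [set u : R | 0 <= u < 1].
have mI : measurable I.
  rewrite (_ : I = [set u | cell [::] u]); first exact: measurable_cell.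
  by apply/seteqP; split => u /=; rewrite cell_nil.
rewrite (_ : _ @^-1` _ =
    (\bigcup_(s in [set: n.-tuple T]) [set u | cell (rcons s x) u])
    `|` (if x == x0 then ~` I else set0)).
  apply: measurableU.
    by apply: fin_bigcup_measurable => // s _; exact: measurable_cell.
  by case: ifP => // _; exact: measurableC.
apply/seteqP; split => u /=.
  case: (boolP (0 <= u < 1)) => u01.
    move=> fux; left.
    have sz : size (pre u n) == n by rewrite size_pre.
    exists (Tuple sz) => //=.
    by have := cell_pre n.+1 u01; rewrite /= -/pre -[dig _ _]/(f u n) fux.
  by rewrite (f_out u01) => <-; right; rewrite eqxx /I /=; apply/negP.
case.
  move=> [s _ c]; have := pre_cell c; rewrite size_rcons size_tuple /=.
  by move=> /rcons_inj[_ <-].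
case: eqP => // -> /negP u01; exact: f_out.
Qed.

Let unit_itv : set (measurableTypeR R) := [set` `[0, 1[].

Let measurable_unit_itv : measurable unit_itv.
Proof. exact: measurable_itv. Qed.

Lemma trajectory_extension : exists P : probability (trajectory x0) R,
  forall s, P [set w | mkseq w (size s) = s] = (W s)%:E.
Proof.
pose g : {mfun measurableTypeR R >-> trajectory x0} :=
  HB.pack_for {mfun measurableTypeR R >-> trajectory x0} f
    (isMeasurableFun.Build _ _ (measurableTypeR R) _ f measurable_f).
pose RR := measurableTypeR R.
pose m : {measure set RR -> \bar R} :=
  mrestr (@lebesgue_measure R) measurable_unit_itv.
have m1 : m setT = 1%E.
  rewrite /m /= /mrestr setTI lebesgue_measure_itv /= lte_fin ltr01.
  by rewrite oppr0 adde0.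
have [P0 P0E] := unit_mass_probability m1.
exists (distribution P0 g) => s.
transitivity (lebesgue_measure [set` `[lo s, lo s + W s[]).
  transitivity (m (f @^-1` [set w | mkseq w (size s) = s])); first exact: P0E.
  rewrite /m /= /mrestr; congr lebesgue_measure.
  apply/seteqP; split => u /=; rewrite !in_itv /=.
    by rewrite mkseq_f => -[<- u01]; apply: cell_pre.
  move=> c; split; last exact: cell_01 c.
  by rewrite mkseq_f; exact: pre_cell.
rewrite lebesgue_measure_itv /= lte_fin ltrDl.
have := W_ge0 s; rewrite le_eqVlt => /predU1P[<-|->]; first by rewrite ltxx.
by rewrite -EFinB addrAC subrr add0r.
Qed.

End trajectory_extension.

Record pomdp (R : realType) (S O A : finType) := Pomdp {
  reward : S -> A -> R;
  trans : S -> A -> fdist R S;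
  obs : S -> fdist R O;
  discount : R;
  init : fdist R S }.

(* [HStep (.. (HStep (HInit o0) a0 o1) ..) a o] is the history
   (o0, a0, o1, .., a, o). *)
Inductive history (O A : Type) : Type :=
| HInit of O
| HStep of history O A & A & O.
Arguments HInit {O A}.

Definition last_obs (O A : Type) (h : history O A) : O :=
  match h with HInit o => o | HStep _ _ o => o end.

Definition policy (R : realType) (O A : finType) : Type :=
  history O A -> fdist R A.

Section trajectories.
Variables S O A : finType.
Implicit Types (w : nat -> S * O * A) (t : nat).

Definition state_at w t : S := (w t).1.1.
Definition obs_at w t : O := (w t).1.2.
Definition act_at w t : A := (w t).2.

Fixpoint history_at w t : history O A :=
  if t is t'.+1 then HStep (history_at w t') (act_at w t') (obs_at w t)
  else HInit (obs_at w 0).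

Lemma eq_history_at w w' t :
  (forall i, (i <= t)%N -> w i = w' i) -> history_at w t = history_at w' t.
Proof.
elim: t => [|t IH] ww'; first by rewrite /= /obs_at ww'.
rewrite /= /obs_at /act_at ww' // ww' // IH // => i it.
exact/ww'/leqW.
Qed.

End trajectories.

Section law.
Variables (R : realType) (S O A : finType).
Variables (M : pomdp R S O A) (pi : policy R O A).

(* The probability that the t-th step is [w t], given that the previous ones
   are those of [w]. *)
Definition step_prob (w : nat -> S * O * A) (t : nat) : R :=
  (if t is t'.+1 then trans M (state_at w t') (act_at w t') else init M)
    (state_at w t)
  * obs M (state_at w t) (obs_at w t)
  * pi (history_at w t) (act_at w t).

Definition some_step : S * O * A :=
  let s := fdist_pick (init M) in
  let o := fdist_pick (obs M s) in
  (s, o, fdist_pick (pi (HInit o))).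

Lemma step_prob_ge0 w t : 0 <= step_prob w t.
Proof. by rewrite !mulr_ge0 ?fdist_ge0. Qed.

Lemma eq_step_prob w w' t :
  (forall i, (i <= t)%N -> w i = w' i) -> step_prob w t = step_prob w' t.
Proof.
move=> ww'; rewrite /step_prob (eq_history_at ww') /state_at /obs_at /act_at.
by case: t ww' => [|t] ww'; rewrite !ww'.
Qed.

Lemma sum_step_prob (w : nat -> S * O * A) n :
  \sum_x step_prob (fun i => if (i < n)%N then w i else x) n = 1.
Proof.
pose d := if n is m.+1 then trans M (state_at w m) (act_at w m) else init M.
pose h o := if n is m.+1 then HStep (history_at w m) (act_at w m) o
            else HInit o.
rewrite (eq_bigr (fun x : S * O * A =>
    d x.1.1 * obs M x.1.1 x.1.2 * pi (h x.1.2) x.2)); last first.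
  move=> x _; rewrite /step_prob /d /h /state_at /obs_at /act_at.
  case: n {d h} => [|m]; first by rewrite /= /obs_at.
  rewrite ltnS leqnn ltnn /= /obs_at /act_at ltnS leqnn ltnn.
  rewrite (@eq_history_at _ _ _ _ w) // => i im.
  by rewrite ltnS im.
rewrite -(pair_bigA _ (fun so a => d so.1 * obs M so.1 so.2 * pi (h so.2) a)) /=.
under eq_bigr do rewrite -mulr_sumr fdist_sum1 mulr1.
rewrite -(pair_bigA _ (fun s o => d s * obs M s o)) /=.
under eq_bigr do rewrite -mulr_sumr fdist_sum1 mulr1.
exact: fdist_sum1.
Qed.

Lemma traj_law_exists : exists P : probability (trajectory some_step) R,
  forall w n, P [set w' | forall i, (i < n)%N -> w' i = w i]
              = (\prod_(i < n) step_prob w i)%:E.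
Proof.
pose W s := \prod_(i < size s) step_prob (nth some_step s) i.
have [|||P PE] := @trajectory_extension R _ some_step W.
- by rewrite /W big_ord0.
- by move=> s; apply: prodr_ge0 => i _; exact: step_prob_ge0.
- move=> s; transitivity (W s * 1); last by rewrite mulr1.
  rewrite -[X in _ * X](sum_step_prob (nth some_step s) (size s)) mulr_sumr /W.
  apply: eq_bigr => x _; rewrite size_rcons big_ord_recr /=; congr (_ * _).
    apply: eq_bigr => i _; apply: eq_step_prob => j ji.
    by rewrite nth_rcons (leq_ltn_trans ji).
  apply: eq_step_prob => j js; rewrite nth_rcons; case: ltnP => // sj.
  by rewrite eqn_leq js sj.
exists P => w n.
transitivity (W (mkseq w n))%:E.
  rewrite -PE; congr (P _); apply/seteqP; split => w' /=; rewrite size_mkseq.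
    by move=> ww'; apply: (@eq_from_nth _ some_step); rewrite !size_mkseq // => i ?;
      rewrite !nth_mkseq // ww'.
  by move=> ww' i ni; rewrite -(nth_mkseq some_step w' ni) ww' nth_mkseq.
rewrite /W size_mkseq; congr EFin; apply: eq_bigr => i _.
apply: eq_step_prob => j ji; rewrite nth_mkseq //; exact: leq_ltn_trans ji _.
Qed.

(* The law of the process (s_t, o_t, a_t)_t under [pi]; being fixed on the
   finite-dimensional cylinders, it is the only probability satisfying
   [traj_lawE]. *)
Definition traj_law : probability (trajectory some_step) R :=
  projT1 (cid traj_law_exists).

Lemma traj_lawE w n :
  traj_law [set w' | forall i, (i < n)%N -> w' i = w i]
  = (\prod_(i < n) step_prob w i)%:E.
Proof. by rewrite /traj_law; case: cid. Qed.

Definition discounted_return (w : nat -> S * O * A) : R :=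
  limn (series (fun t =>
    discount M ^+ t * reward M (state_at w t) (act_at w t))).

Definition value : \bar R := ('E_traj_law[discounted_return])%E.

End law.

Definition optimal_pomdp (R : realType) (S O A : finType) (M : pomdp R S O A)
    (pi : policy R O A) : Prop :=
  forall pi' : policy R O A, (value M pi' <= value M pi)%E.

(* [None] stands for the symbol of absence. *)
Definition labelling (O A : finType) (Sym : Type) : Type :=
  option O -> option A -> O -> set Sym.

Record reward_machine (R : realType) (Sym : Type) (U : finType) := RewardMachine {
  rm_init : U;
  rm_trans : U -> set Sym -> U;
  rm_reward : U -> set Sym -> R }.

Section reward_machines.
Variables (R : realType) (S O A : finType) (Sym : Type) (U : finType).
Variables (M : pomdp R S O A) (L : labelling O A Sym).
Variable (RM : reward_machine R Sym U).

Fixpoint rm_state (h : history O A) : U :=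
  match h with
  | HInit _ => rm_init RM
  | HStep h' a o =>
      rm_trans RM (rm_state h') (L (Some (last_obs h')) (Some a) o)
  end.

Definition cond_prob d (T : measurableType d) (P : probability T R)
    (E F : set T) : R :=
  fine (P (E `&` F)) / fine (P F).

(* The trace (o_0, a_0, .., o_t, a_t) is given as the history [h] up to o_t
   together with a_t = [a]. *)
Definition perfect_rm : Prop :=
  exists q : O -> R -> O -> U -> A -> R,
  forall (pi : policy R O A) (t : nat) (h : history O A) (a : A),
    let P := traj_law M pi in
    let trace := [set w | history_at w t = h /\ act_at w t = a] in
    (0 < P trace)%E ->
    forall (o' : O) (rho : R),
      cond_prob P
        [set w | obs_at w t.+1 = o' /\
                 reward M (state_at w t) (act_at w t) = rho] trace
      = q o' rho (last_obs h) (rm_state h) a.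

Definition rm_policy : Type := O -> U -> fdist R A.

Definition execute (pi : rm_policy) : policy R O A :=
  fun h => pi (last_obs h) (rm_state h).

Definition optimal_rm (pi : rm_policy) : Prop :=
  forall pi' : rm_policy, (value M (execute pi') <= value M (execute pi))%E.

End reward_machines.

(* Main.v *)
(* Bellman's equation for the kernel q of the perfect machine has a bounded
   solution V on O * U. For a policy of the POMDP, let J n be the expected
   return of the first n steps plus gamma^n V(o_n, x_n). Perfectness gives the
   law of (r_n, o_{n+1}) conditionally on the trace up to a_n, whence
   J (n+1) <= J n, with equality when the policy is greedy for V. Since J n
   tends to the value of the policy and J 0 is the same for all policies, a
   greedy policy, which only reads (o, u), dominates every history-dependent
   policy. *)
Require Import Defs.
From HB Require Import structures.
From mathcomp Require Import all_boot all_order all_algebra.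
From mathcomp Require Import all_classical all_reals all_analysis.
From mathcomp Require Import measurable_realfun ring.

Set Implicit Arguments.
Unset Strict Implicit.
Unset Printing Implicit Defensive.

Import Order.TTheory GRing.Theory Num.Theory.
Import numFieldNormedType.Exports.

Local Open Scope ring_scope.

(* The infimum of the bounded supersolutions is a solution, as in the
   Knaster-Tarski theorem. *)
Lemma bellman_solution (R : realType) (X A : finType) (a0 : A) (K : R)
    (Q : (X -> R) -> X -> A -> R) :
  (forall V V' : X -> R, (forall x, V x <= V' x) ->
    forall x a, Q V x a <= Q V' x a) ->
  (forall V : X -> R, (forall x, V x <= K) -> forall x a, Q V x a <= K) ->
  (forall V : X -> R, (forall x, - K <= V x) -> forall x a, - K <= Q V x a) ->
  0 <= K ->
  exists V : X -> R, [/\ forall x, `|V x| <= K,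
    forall x a, Q V x a <= V x & forall x, exists a, Q V x a = V x].
Proof.
move=> Qmono Qle Qge K0.
(* The lower bound [- K] is built into supersolutions so that their pointwise infimum exists in
   [R]. *)
pose sup_sol (V : X -> R) :=
  (forall x, - K <= V x) /\ forall x a, Q V x a <= V x.
have sup_solK : sup_sol (fun=> K).
  split=> [x|x a]; last exact: Qle.
  by rewrite (le_trans _ K0) // oppr_le0.
pose E x : set R := [set V x | V in sup_sol]%classic.
have E0 x : (E x !=set0)%classic by exists K; exists (fun=> K).
have Elb x : lbound (E x) (- K) by move=> _ [V [Vge _] <-].
pose V x := inf (E x).
have V_le V' x : sup_sol V' -> V x <= V' x.
  by move=> sV'; apply: ge_inf; [exists (- K)|exists V'].
have QV x a : Q V x a <= V x.
  apply: lb_le_inf => // _ [V' sV' <-].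
  by apply: le_trans (sV'.2 x a); apply: Qmono => y; exact: V_le.
have Vge x : - K <= V x by apply: lb_le_inf.
exists V; split=> // [x|x].
  by rewrite ler_norml Vge (V_le _ _ sup_solK).
pose greedy y := [arg max_(a > a0) Q V y a]%O.
have greedyP y a : Q V y a <= Q V y (greedy y).
  by rewrite /greedy; case: arg_maxP => // b _; apply.
(* The function [fun y => Q V y (greedy y)] lies below [V], so by monotonicity it is again a
   supersolution; minimality of [V] then gives the reverse inequality. *)
exists (greedy x); apply: le_anti; rewrite QV /=.
apply: (V_le (fun y => Q V y (greedy y))); split=> [y|y a]; first exact: Qge.
by apply: le_trans (greedyP y a); apply: Qmono.
Qed.

(** A finite form of conditioning on [g]. The type [X] is arbitrary because it will hold histories,
    which form no finite type. *)
Lemma eq_sum_fibers (R : nmodType) (I : finType) (X : Type) (g : I -> X)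
    (F G : I -> R) :
  (forall j, \sum_(i | `[< g i = g j >]) F i
           = \sum_(i | `[< g i = g j >]) G i) ->
  \sum_i F i = \sum_i G i.
Proof.
move=> FG.
(* A chosen representative stands for the value [g i], so that the sums can be partitioned over the
   finite type [option I]. *)
pose key i := [pick j | `[< g j = g i >]].
have keyE i j : (key i == key j) = `[< g i = g j >].
  apply/eqP/asboolP => [|gij]; last by apply: eq_pick => k /=; rewrite gij.
  rewrite /key; case: pickP => [k /asboolP <-|/(_ i)]; last by rewrite asboolT.
  by case: pickP => // l /asboolP <- [->].
rewrite (partition_big key predT) //= [RHS](partition_big key predT) //=.
apply: eq_bigr => k _; case: (pickP (fun j => key j == k)) => [j /eqP <-|k0].
  by under eq_bigl do rewrite keyE; under [RHS]eq_bigl do rewrite keyE.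
by rewrite !big_pred0.
Qed.

(** * Functions of finitely many steps and their expectations *)

Definition cylinder (T : Type) (n : nat) (w : nat -> T) : set (nat -> T) :=
  [set w' | forall i, (i < n)%N -> w' i = w i]%classic.

(** Stated on [nat -> T] rather than on [trajectory x0], whose base point depends on the policy: the
    same [f] then serves all policies. *)
Definition determined_by_first (T Y : Type) (n : nat) (f : (nat -> T) -> Y) :
    Prop :=
  forall w w', (forall i, (i < n)%N -> w i = w' i) -> f w = f w'.

Lemma determined_by_first_leq (T Y : Type) (m n : nat) (f : (nat -> T) -> Y) :
  (m <= n)%N -> determined_by_first m f -> determined_by_first n f.
Proof.
move=> mn df w w' ww'; apply: df => i im; apply: ww'.
exact: leq_trans im mn.
Qed.

Section cylinders.
Variables (R : realType) (T : finType) (x0 : T).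
Variable P : probability (trajectory x0) R.

Lemma measurable_cylinder (n : nat) (w : nat -> T) :
  measurable (cylinder n w : set (trajectory x0)).
Proof.
elim: n => [|n IH].
  by rewrite (_ : cylinder 0 w = setT) //; apply/seteqP; split.
rewrite (_ : cylinder n.+1 w
  = (cylinder n w `&` [set w' | w' n = w n])%classic); last first.
  apply/seteqP; split=> w' /=.
    by move=> h; split=> [i im|]; apply: h => //; exact: ltnW.
  move=> [h1 h2] i; rewrite ltnS leq_eqVlt => /predU1P[->//|]; exact: h1.
apply: measurableI => //; apply: sub_sigma_algebra.
by exists n, (w n).
Qed.

(** The cylinders of the [n]-tuples partition the trajectories, so [f] is a simple function. The
    default [x0] beyond index [n] is never read by [f]. *)
Lemma determined_by_first_sum (n : nat) (f : (nat -> T) -> R)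
    (w : trajectory x0) : determined_by_first n f ->
  f w = \sum_(s : n.-tuple T)
    f (nth x0 s) * \1_(cylinder n (nth x0 s)) w.
Proof.
move=> df; have sz : size (mkseq w n) == n by rewrite size_mkseq.
rewrite (bigD1 (Tuple sz)) //= big1 => [|s sw].
  rewrite addr0 indicE mem_set ?mulr1 => [|i im]; last by rewrite nth_mkseq.
  by apply: df => i im; rewrite nth_mkseq.
rewrite indicE memNset ?mulr0 // => ws; move/eqP: sw; apply.
apply: val_inj; apply: (@eq_from_nth _ x0); rewrite ?size_tuple ?size_mkseq //.
by move=> i im; rewrite nth_mkseq // ws.
Qed.

Lemma determined_by_first_measurable (n : nat) (f : trajectory x0 -> R) :
  determined_by_first n f -> measurable_fun setT f.
Proof.
move=> df.
rewrite (_ : f = fun w => \sum_(s : n.-tuple T)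
    f (nth x0 s) * \1_(cylinder n (nth x0 s)) w); last first.
  by apply/funext => w; exact: determined_by_first_sum.
apply: measurable_sum => s; apply: measurable_funM => //.
by apply: measurable_indic; exact: measurable_cylinder.
Qed.

Lemma expectation_determined (n : nat) (f : trajectory x0 -> R) :
  determined_by_first n f ->
  'E_P[f]%E = (\sum_(s : n.-tuple T)
    f (nth x0 s) * fine (P (cylinder n (nth x0 s))))%:E.
Proof.
move=> df; rewrite unlock.
under eq_integral => w _ do rewrite (determined_by_first_sum _ df) -sumEFin.
have ic (s : n.-tuple T) : P.-integrable setT
    (fun w => (\1_(cylinder n (nth x0 s)) w)%:E).
  by apply: integrable_indic; exact: measurable_cylinder.
rewrite integral_sum //= => [|s]; last first.
  under eq_fun do rewrite EFinM.
  exact: integrableZl.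
rewrite -sumEFin; apply: eq_bigr => s _.
under eq_integral do rewrite EFinM.
rewrite integralZl // integral_indic //; last exact: measurable_cylinder.
rewrite setIT EFinM fineK // fin_num_measure //; exact: measurable_cylinder.
Qed.

Lemma probability_determined (n : nat) (B : (nat -> T) -> bool) :
  determined_by_first n B ->
  P [set w | B w]%classic = (\sum_(s : n.-tuple T | B (nth x0 s))
    fine (P (cylinder n (nth x0 s))))%:E.
Proof.
move=> dB; pose f (w : trajectory x0) : R := (B w)%:R.
have df : determined_by_first n f by move=> w w' /dB; rewrite /f => ->.
(* As a preimage under [f], the event inherits measurability from [f], and its indicator is [f]
   itself. *)
rewrite big_mkcond (_ : [set w | B w]%classic = (f @^-1` [set 1])%classic).
  have mB : measurable (f @^-1` [set 1])%classic.
    rewrite -[X in measurable X]setTI.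
    exact: (determined_by_first_measurable df).
  rewrite -(expectation_indic P mB).
  rewrite (_ : \1_(f @^-1` [set 1])%classic = f).
    rewrite (expectation_determined df); congr EFin; apply: eq_bigr => s _.
    by rewrite /f; case: ifP; rewrite ?mul1r ?mul0r.
  apply/funext => w; rewrite indicE /f; case: (boolP (B w)) => Bw.
    by rewrite mem_set //= Bw.
  by rewrite memNset //= (negbTE Bw) => /eqP; rewrite eq_sym oner_eq0.
apply/seteqP; split => w /=; rewrite /f; first by move=> ->.
by case: (B w) => // /eqP; rewrite eq_sym oner_eq0.
Qed.

End cylinders.

(** * The Bellman operator of the kernel [q] *)

Section bellman_operator.
Variables (R : realType) (S O A : finType) (M : pomdp R S O A).
Variables (Sym : Type) (L : labelling O A Sym).
Variables (U : finType) (RM : reward_machine R Sym U).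
Variable q : O -> R -> O -> U -> A -> R.

(** A finite list makes it possible to sum a kernel over real rewards; without [undup] a repeated
    reward would be counted several times. *)
Definition reward_values : seq R :=
  undup [seq reward M s a | s <- enum S, a <- enum A].

Definition reward_bound : R := \sum_(rho <- reward_values) `|rho|.

Lemma reward_in_values s a : reward M s a \in reward_values.
Proof.
by rewrite mem_undup; apply: allpairs_f; rewrite mem_enum.
Qed.

Lemma le_reward_bound rho : rho \in reward_values -> `|rho| <= reward_bound.
Proof.
move=> rv; rewrite /reward_bound (bigD1_seq rho) ?undup_uniq //=.
by rewrite lerDl sumr_ge0.
Qed.

Lemma reward_bound_ge0 : 0 <= reward_bound.
Proof. exact: sumr_ge0. Qed.

Definition substochastic (o : O) (u : U) (a : A) : bool :=
  all (fun rho => [forall o', 0 <= q o' rho o u a]) reward_values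
  && (\sum_(rho <- reward_values) \sum_o' q o' rho o u a <= 1).

(* [q] is arbitrary at the triples that no policy reaches; replacing it by [0]
   where it is not substochastic makes [bellman] preserve bounds. *)
Definition subkernel (o' : O) (rho : R) (o : O) (u : U) (a : A) : R :=
  if substochastic o u a then q o' rho o u a else 0.

Lemma subkernel_ge0 o' rho o u a :
  rho \in reward_values -> 0 <= subkernel o' rho o u a.
Proof.
rewrite /subkernel; case: ifP => // /andP[/allP h _] /h /forallP; exact.
Qed.

Lemma sum_subkernel_le1 o u a :
  \sum_(rho <- reward_values) \sum_o' subkernel o' rho o u a <= 1.
Proof.
rewrite /subkernel; have [/andP[]//|_] := boolP (substochastic o u a).
by rewrite big1 // => rho _; rewrite big1.
Qed.

Definition rm_next (x : O * U) (a : A) (o' : O) : O * U :=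
  (o', rm_trans RM x.2 (L (Some x.1) (Some a) o')).

(** The action value of [a] at [x] when [V] is the continuation value; the maximum over [a] is taken
    in [bellman_solution]. *)
Definition bellman (V : O * U -> R) (x : O * U) (a : A) : R :=
  \sum_(rho <- reward_values) \sum_o'
    subkernel o' rho x.1 x.2 a * (rho + discount M * V (rm_next x a o')).

Hypothesis gamma_range : 0 <= discount M < 1.

(** The sum of the geometric series of discounted reward bounds, and the fixed point of
    [K -> reward_bound + discount M * K]. *)
Definition value_bound : R := reward_bound / (1 - discount M).

Lemma value_boundE : reward_bound + discount M * value_bound = value_bound.
Proof.
rewrite /value_bound; have : 1 - discount M != 0.
  by rewrite subr_eq0 gt_eqF //; case/andP: gamma_range.
by move=> ?; field.
Qed.

Lemma value_bound_ge0 : 0 <= value_bound.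
Proof.
rewrite divr_ge0 ?reward_bound_ge0 // subr_ge0 ltW //.
by case/andP: gamma_range.
Qed.

Let gamma_ge0 : 0 <= discount M. Proof. by case/andP: gamma_range. Qed.

Lemma bellman_mono (V V' : O * U -> R) :
  (forall x, V x <= V' x) -> forall x a, bellman V x a <= bellman V' x a.
Proof.
move=> VV' x a; rewrite /bellman [leLHS]big_seq [leRHS]big_seq.
apply: ler_sum => rho rv; apply: ler_sum => o' _.
by rewrite ler_wpM2l ?subkernel_ge0 // lerD2l ler_wpM2l.
Qed.

(** Each weight multiplies at most [K], and the weights sum to at most 1; [0 <= K] absorbs any
    missing mass. *)
Lemma bellman_le (K : R) (V : O * U -> R) :
  0 <= K -> reward_bound + discount M * K <= K ->
  (forall x, V x <= K) -> forall x a, bellman V x a <= K.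
Proof.
move=> K0 KK VK x a.
apply: (@le_trans _ _ ((\sum_(rho <- reward_values) \sum_o'
    subkernel o' rho x.1 x.2 a) * K)).
  rewrite mulr_suml [leLHS]big_seq [leRHS]big_seq; apply: ler_sum => rho rv.
  rewrite mulr_suml; apply: ler_sum => o' _.
  rewrite ler_wpM2l ?subkernel_ge0 //; apply: le_trans KK.
  by rewrite lerD ?ler_wpM2l // (le_trans (ler_norm _)) // le_reward_bound.
by rewrite -[leRHS]mul1r ler_wpM2r // sum_subkernel_le1.
Qed.

Lemma bellman_ge (K : R) (V : O * U -> R) :
  0 <= K -> reward_bound + discount M * K <= K ->
  (forall x, - K <= V x) -> forall x a, - K <= bellman V x a.
Proof.
move=> K0 KK VK x a.
apply: (@le_trans _ _ ((\sum_(rho <- reward_values) \sum_o'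
    subkernel o' rho x.1 x.2 a) * - K)); last first.
  rewrite mulr_suml [leLHS]big_seq [leRHS]big_seq; apply: ler_sum => rho rv.
  rewrite mulr_suml; apply: ler_sum => o' _.
  rewrite ler_wpM2l ?subkernel_ge0 //.
  apply: (@le_trans _ _ (- (reward_bound + discount M * K))).
    by rewrite lerN2.
  rewrite opprD -mulrN lerD ?ler_wpM2l // lerNl.
  by rewrite (le_trans _ (le_reward_bound rv)) // -normrN ler_norm.
by rewrite mulrN lerN2 -[leRHS]mul1r ler_wpM2r // sum_subkernel_le1.
Qed.

Lemma bellman_optimal_value (a0 : A) :
  exists V : O * U -> R, [/\ forall x, `|V x| <= value_bound,
    forall x a, bellman V x a <= V x & forall x, exists a, bellman V x a = V x].
Proof.
have K0 := value_bound_ge0; have KK := value_boundE.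
apply: (bellman_solution a0) => //.
- exact: bellman_mono.
- by move=> V; apply: bellman_le => //; rewrite KK.
- by move=> V; apply: bellman_ge => //; rewrite KK.
Qed.

End bellman_operator.

(** * One step of the process, conditioned on the trace *)

Lemma last_obs_history_at (S O A : finType) (w : nat -> S * O * A) t :
  last_obs (history_at w t) = obs_at w t.
Proof. by case: t. Qed.

Section process.
Variables (R : realType) (S O A : finType) (M : pomdp R S O A).
Variables (Sym : Type) (L : labelling O A Sym).
Variables (U : finType) (RM : reward_machine R Sym U).
Variable pi : policy R O A.

Notation x0 := (some_step M pi).

Definition rm_at (w : nat -> S * O * A) (t : nat) : O * U :=
  (obs_at w t, rm_state L RM (history_at w t)).

Definition trace_at (w : nat -> S * O * A) (t : nat) : history O A * A :=
  (history_at w t, act_at w t).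

Definition reward_at (w : nat -> S * O * A) (t : nat) : R :=
  reward M (state_at w t) (act_at w t).

Lemma rm_at_succ w t :
  rm_at w t.+1 = rm_next L RM (rm_at w t) (act_at w t) (obs_at w t.+1).
Proof. by rewrite /rm_at /rm_next /= last_obs_history_at. Qed.

Lemma trace_at_determined t : determined_by_first t.+1 (trace_at^~ t).
Proof.
move=> w w' ww'; rewrite /trace_at /act_at ww' //.
by rewrite (@eq_history_at _ _ _ w w').
Qed.

Lemma rm_at_determined t : determined_by_first t.+1 (rm_at^~ t).
Proof.
move=> w w' ww'.
by rewrite /rm_at /obs_at ww' // (@eq_history_at _ _ _ w w').
Qed.

Lemma reward_at_determined t : determined_by_first t.+1 (reward_at^~ t).
Proof. by move=> w w' ww'; rewrite /reward_at /state_at /act_at ww'. Qed.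

Lemma obs_at_determined t :
  determined_by_first t.+1 (fun w => @obs_at S O A w t).
Proof. by move=> w w' ww'; rewrite /obs_at ww'. Qed.

Definition path_prob n (w : nat -> S * O * A) : R :=
  \prod_(i < n) step_prob M pi w i.

Lemma path_prob_ge0 n w : 0 <= path_prob n w.
Proof. by apply: prodr_ge0 => i _; exact: step_prob_ge0. Qed.

Lemma cylinder_path_prob n w :
  traj_law M pi (cylinder n w) = (path_prob n w)%:E.
Proof. exact: traj_lawE. Qed.

Lemma traj_expectation n (f : (nat -> S * O * A) -> R) :
  determined_by_first n f ->
  'E_(traj_law M pi)[f]%E = (\sum_(s : n.-tuple (S * O * A))
    f (nth x0 s) * path_prob n (nth x0 s))%:E.
Proof.
move=> df; rewrite (expectation_determined _ df).
by under eq_bigr do rewrite cylinder_path_prob.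
Qed.

Lemma traj_probability n (B : (nat -> S * O * A) -> bool) :
  determined_by_first n B ->
  traj_law M pi [set w | B w]%classic = (\sum_(s : n.-tuple (S * O * A)
    | B (nth x0 s)) path_prob n (nth x0 s))%:E.
Proof.
move=> dB; rewrite (probability_determined _ dB).
by under eq_bigr do rewrite cylinder_path_prob.
Qed.

(** The clause of [perfect_rm] for the single policy [pi]. *)
Definition predicts (q : O -> R -> O -> U -> A -> R) : Prop :=
  forall (t : nat) (h : history O A) (a : A),
  let P := traj_law M pi in
  let trace := [set w | history_at w t = h /\ act_at w t = a]%classic in
  (0 < P trace)%E -> forall (o' : O) (rho : R),
  cond_prob P [set w | obs_at w t.+1 = o' /\
                 reward M (state_at w t) (act_at w t) = rho]%classic trace
  = q o' rho (last_obs h) (rm_state L RM h) a.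

Variable q : O -> R -> O -> U -> A -> R.
Hypothesis qP : predicts q.

(** Perfectness with the denominator of the conditional probability cleared. The path [s0]
    represents its trace, and [t.+2] coordinates are taken because the next observation sits at
    index [t.+1]. *)
Lemma trace_weightE t (s0 : (t.+2).-tuple (S * O * A)) (o' : O) (rho : R) :
  let w0 := nth x0 s0 in
  let B w := `[< trace_at w t = trace_at w0 t >] in
  let m := \sum_(s : (t.+2).-tuple _ | B (nth x0 s))
    path_prob t.+2 (nth x0 s) in
  m != 0 ->
  \sum_(s : (t.+2).-tuple _ | B (nth x0 s)
      && ((obs_at (nth x0 s) t.+1 == o') && (reward_at (nth x0 s) t == rho)))
    path_prob t.+2 (nth x0 s)
  = q o' rho (rm_at w0 t).1 (rm_at w0 t).2 (act_at w0 t) * m.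
Proof.
move=> w0 B m m0.
have dB : determined_by_first t.+2 B.
  move=> w w' ww'; rewrite /B; congr `[< _ = _ >].
  by apply: (determined_by_first_leq _ (@trace_at_determined t)) ww'.
have m_gt0 : 0 < m.
  by rewrite lt_neqAle eq_sym m0 sumr_ge0 // => s _; exact: path_prob_ge0.
pose trace : set (nat -> S * O * A) :=
  [set w | history_at w t = history_at w0 t /\
           act_at w t = act_at w0 t]%classic.
have traceE : trace = [set w | B w]%classic.
  apply/seteqP; split=> w /=; rewrite /B /trace /=.
    by move=> [h1 h2]; apply/asboolP; rewrite /trace_at h1 h2.
  by move=> /asboolP[].
have Ptrace : traj_law M pi trace = m%:E.
  by rewrite traceE (traj_probability dB).
have Ptrace_gt0 : (0 < traj_law M pi trace)%E by rewrite Ptrace lte_fin.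
rewrite /rm_at /= -(last_obs_history_at w0) -(qP Ptrace_gt0) /cond_prob.
rewrite -/trace Ptrace /= divfK //.
rewrite setIC traceE.
pose BE w := B w && ((obs_at w t.+1 == o') && (reward_at w t == rho)).
rewrite (_ : (_ `&` _)%classic = [set w | BE w]%classic); last first.
  apply/seteqP; split=> w /=; rewrite /BE /reward_at.
    by move=> [-> [-> ->]]; rewrite !eqxx.
  by move=> /andP[-> /andP[/eqP -> /eqP ->]].
suff dBE : determined_by_first t.+2 BE by rewrite (traj_probability dBE).
move=> w w' ww'; rewrite /BE (dB _ _ ww').
rewrite (obs_at_determined ww').
by rewrite (determined_by_first_leq _ (@reward_at_determined t) ww').
Qed.

(** Each index [i] matches exactly one pair [(rho, o')], since the list of rewards has no
    duplicates. *)
Lemma sum_by_reward_obs (I : finType) (D : pred I) (r : I -> R) (o : I -> O)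
    (p : I -> R) (F : R -> O -> R) :
  (forall i, r i \in reward_values M) ->
  \sum_(i | D i) F (r i) (o i) * p i
  = \sum_(rho <- reward_values M) \sum_o'
      F rho o' * \sum_(i | D i && ((o i == o') && (r i == rho))) p i.
Proof.
move=> rv; pose c i rho o' := (o i == o') && (r i == rho).
transitivity (\sum_(rho <- reward_values M) \sum_o' \sum_(i | D i)
    if c i rho o' then F rho o' * p i else 0).
  under [RHS]eq_bigr do rewrite exchange_big.
  rewrite exchange_big; apply: eq_bigr => i _.
  rewrite (bigD1_seq (r i)) ?undup_uniq //= [X in _ + X]big1 => [|rho nr].
    rewrite addr0 (bigD1 (o i)) //= big1 => [|o' no].
      by rewrite /c !eqxx addr0.
    by rewrite /c eq_sym (negbTE no).
  by rewrite big1 // => o' _; rewrite /c andbC eq_sym (negbTE nr).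
apply: eq_bigr => rho _; apply: eq_bigr => o' _.
by rewrite mulr_sumr big_mkcondr.
Qed.

(** The tower property: conditioning on the trace up to the action at [t] turns the reward and next
    value into the action value. The equality is checked on each fibre of [trace_at]. *)
Lemma sum_bellman_step t (V : O * U -> R) :
  \sum_(s : (t.+2).-tuple (S * O * A))
    (reward_at (nth x0 s) t + discount M * V (rm_at (nth x0 s) t.+1))
    * path_prob t.+2 (nth x0 s)
  = \sum_(s : (t.+2).-tuple (S * O * A))
    bellman M L RM q V (rm_at (nth x0 s) t) (act_at (nth x0 s) t)
    * path_prob t.+2 (nth x0 s).
Proof.
apply: (eq_sum_fibers (g := fun s : (t.+2).-tuple _ => trace_at (nth x0 s) t)).
move=> s0; set w0 := nth x0 s0.
pose B w := `[< trace_at w t = trace_at w0 t >].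
pose m := \sum_(s : (t.+2).-tuple _ | B (nth x0 s))
    path_prob t.+2 (nth x0 s).
(* On a trace of weight zero perfectness says nothing about [q], but every path there has weight
   zero and both sides vanish. *)
have [m0|m0] := eqVneq m 0.
  have p0 (s : (t.+2).-tuple _) :
      B (nth x0 s) -> path_prob t.+2 (nth x0 s) = 0.
    move: m0 => /eqP; rewrite psumr_eq0 => [|i _]; last exact: path_prob_ge0.
    by move=> /allP /(_ s (mem_index_enum s)) /implyP h /h /eqP.
  by rewrite !big1 // => s Bs; rewrite p0 ?mulr0.
pose x := rm_at w0 t; pose a := act_at w0 t.
have BE w : B w -> rm_at w t = x /\ act_at w t = a.
  move=> /asboolP e; split; last by rewrite -[LHS]/((trace_at w t).2) e.
  rewrite /x /rm_at -!last_obs_history_at.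
  by rewrite -[history_at w t]/((trace_at w t).1) e.
have qm o' rho := @trace_weightE t s0 o' rho m0.
have rv (s : (t.+2).-tuple _) : reward_at (nth x0 s) t \in reward_values M.
  exact: reward_in_values.
(* On a trace of positive weight [m], the products of [q] with [m] are weights of disjoint events
   filling the trace; hence [q] is nonnegative with total mass 1, and [subkernel] agrees with it. *)
have sub : substochastic M q x.1 x.2 a.
  apply/andP; split.
    apply/allP => rho _; apply/forallP => o'.
    have m_gt0 : 0 < m.
      by rewrite lt_neqAle eq_sym m0 sumr_ge0 // => s _; exact: path_prob_ge0.
    rewrite -(pmulr_lge0 _ m_gt0) -/x -qm.
    by apply: sumr_ge0 => s _; exact: path_prob_ge0.
  rewrite le_eqVlt; apply/orP; left; rewrite -(inj_eq (mulIf m0)) mul1r.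
  apply/eqP; rewrite mulr_suml.
  transitivity (\sum_(s : (t.+2).-tuple _ | B (nth x0 s))
      1 * path_prob t.+2 (nth x0 s)); last by under eq_bigr do rewrite mul1r.
  rewrite (sum_by_reward_obs _
    (fun s : (t.+2).-tuple _ => obs_at (nth x0 s) t.+1)
    _ (fun _ _ => 1) rv).
  apply: eq_bigr => rho _; rewrite mulr_suml; apply: eq_bigr => o' _.
  by rewrite mul1r qm.
pose F rho o' := rho + discount M * V (rm_next L RM x a o').
transitivity (\sum_(s : (t.+2).-tuple _ | B (nth x0 s))
    F (reward_at (nth x0 s) t) (obs_at (nth x0 s) t.+1)
    * path_prob t.+2 (nth x0 s)).
  by apply: eq_bigr => s /BE[xE aE]; rewrite rm_at_succ xE aE.
transitivity (bellman M L RM q V x a * m); last first.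
  by rewrite mulr_sumr; apply: eq_bigr => s /BE[-> ->].
rewrite (sum_by_reward_obs _
    (fun s : (t.+2).-tuple _ => obs_at (nth x0 s) t.+1)
    _ F rv).
rewrite mulr_suml; apply: eq_bigr => rho _.
rewrite mulr_suml; apply: eq_bigr => o' _.
by rewrite qm /subkernel sub mulrA [X in X * _]mulrC.
Qed.

End process.

(** * Bootstrapped returns and their limit *)

Section value_limit.
Variables (R : realType) (S O A : finType) (M : pomdp R S O A).
Variables (Sym : Type) (L : labelling O A Sym).
Variables (U : finType) (RM : reward_machine R Sym U).
Variables (V : O * U -> R) (K : R) (pi : policy R O A).
Hypothesis gamma_range : 0 <= discount M < 1.
Hypothesis V_bounded : forall x, `|V x| <= K.

Notation x0 := (some_step M pi).

Definition partial_return (w : nat -> S * O * A) (n : nat) : R :=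
  \sum_(0 <= t < n) discount M ^+ t * reward_at M w t.

(** Its expectation is the quantity [J n]. *)
Definition bootstrapped_return (n : nat) (w : nat -> S * O * A) : R :=
  partial_return w n + discount M ^+ n * V (rm_at L RM w n).

Lemma partial_return_determined n :
  determined_by_first n (fun w => partial_return w n).
Proof.
move=> w w' ww'; apply: eq_big_nat => t /andP[_ tn]; congr (_ * _).
by apply: (determined_by_first_leq tn (@reward_at_determined _ _ _ _ M t)).
Qed.

Lemma bootstrapped_return_determined n :
  determined_by_first n.+1 (bootstrapped_return n).
Proof.
move=> w w' ww'; rewrite /bootstrapped_return.
rewrite (determined_by_first_leq _ (@partial_return_determined n) ww') //.
by rewrite (rm_at_determined L RM ww').
Qed.

Let gamma_ge0 : 0 <= discount M. Proof. by case/andP: gamma_range. Qed.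
Let gamma_norm : `|discount M| < 1.
Proof. by rewrite ger0_norm //; case/andP: gamma_range. Qed.

(** Comparison with the geometric series. The bound is uniform in [w] and [n], so it gives both
    absolute convergence and a dominating constant. *)
Lemma sum_normr_reward_le w n :
  \sum_(0 <= t < n) `|discount M ^+ t * reward_at M w t| <= value_bound M.
Proof.
apply: (@le_trans _ _ (series (geometric (reward_bound M) (discount M)) n)).
  apply: ler_sum => t _.
  rewrite /geometric /= normrM ger0_norm ?exprn_ge0 // mulrC.
  rewrite ler_wpM2r ?exprn_ge0 // le_reward_bound //.
  exact: reward_in_values.
have cvg_geo := @cvg_geometric_series _ (reward_bound M) _ gamma_norm.
rewrite /value_bound -(cvg_lim _ cvg_geo) //.
apply: nondecreasing_cvgn_le; last exact: is_cvg_geometric_series.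
apply/nondecreasing_seqP => k; rewrite /series /= big_nat_recr //= lerDl.
by rewrite mulr_ge0 ?exprn_ge0 ?reward_bound_ge0.
Qed.

Lemma partial_return_cvg w :
  (partial_return w @ \oo --> discounted_return M w)%classic.
Proof.
rewrite /discounted_return -/(series _).
(* As [discounted_return] is defined by [limn], convergence to it is just convergence. *)
suff : cvgn (series (fun t => discount M ^+ t * reward_at M w t)) by [].
apply: normed_cvg; apply: nondecreasing_is_cvgn.
  by apply/nondecreasing_seqP => k; rewrite [leRHS]seriesSr lerDl /= normr_ge0.
by exists (value_bound M) => _ [n _ <-]; exact: sum_normr_reward_le.
Qed.

Lemma bootstrapped_return_cvg w :
  (bootstrapped_return n w @[n --> \oo] --> discounted_return M w)%classic.
Proof.
rewrite -[X in (_ --> X)%classic]addr0.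
apply: cvgD; first exact: partial_return_cvg.
apply/norm_cvg0P.
apply: (@squeeze_cvgr _ _ _ _ (fun=> 0) (geometric K (discount M))).
- near=> n; rewrite normr_ge0 /= normrM ger0_norm ?exprn_ge0 // mulrC.
  by rewrite ler_wpM2r ?exprn_ge0.
- exact: cvg_cst.
- exact: cvg_geometric.
Unshelve. all: by end_near.
Qed.

(** Dominated convergence: pointwise the bootstrap term vanishes, and all returns are bounded by the
    constant [value_bound M + K]. *)
Lemma value_cvg :
  ('E_(traj_law M pi)[bootstrapped_return n] @[n --> \oo]
    --> value M pi)%E%classic.
Proof.
rewrite /value unlock.
apply: (@dominated_cvg _ _ _ _ _ measurableT _ _
  (fun=> (value_bound M + K)%:E)) => //.
- move=> n; apply/measurable_EFinP.
  exact: determined_by_first_measurable (@bootstrapped_return_determined n).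
- move=> w _; apply/cvg_EFin; first by apply: nearW.
  exact: bootstrapped_return_cvg.
- exact: (finite_measure_integrable_cst (traj_law M pi) _ measurableT).
move=> n w _; rewrite lee_fin (le_trans (ler_normD _ _)) // lerD //.
  by rewrite (le_trans (ler_norm_sum _ _ _)) // sum_normr_reward_le.
rewrite normrM ger0_norm ?exprn_ge0 // -[leRHS]mul1r.
by rewrite ler_pM ?exprn_ge0 // exprn_ile1 // ltW //; case/andP: gamma_range.
Qed.

(** The first action sums out, leaving a number free of [pi]: the common starting point [J 0] of all
    policies. *)
Lemma expectation_bootstrapped_return0 :
  'E_(traj_law M pi)[bootstrapped_return 0]%E
  = (\sum_s \sum_o init M s * obs M s o * V (o, rm_init RM))%:E.
Proof.
rewrite (traj_expectation M pi (@bootstrapped_return_determined 0)); congr EFin.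
pose f (x : S * O * A) := [tuple x].
have fK : cancel f (@thead _ _) by [].
rewrite (reindex f); last first.
  exists (@thead _ _) => // s _.
  by case/tupleP: s => x s; apply: val_inj; rewrite /= (tuple0 s).
transitivity (\sum_(x : S * O * A)
  init M x.1.1 * obs M x.1.1 x.1.2 * V (x.1.2, rm_init RM)
  * pi (HInit x.1.2) x.2).
  apply: eq_bigr => x _; rewrite /bootstrapped_return /partial_return big_nil.
  rewrite add0r expr0 mul1r /path_prob big_ord1 /step_prob /rm_at /=.
  rewrite /state_at /obs_at /act_at /=.
  by rewrite -mulrA mulrC -!mulrA; congr (_ * (_ * _)); rewrite mulrC.
rewrite -(pair_bigA _ (fun so a => init M so.1 * obs M so.1 so.2
  * V (so.2, rm_init RM) * pi (HInit so.2) a)) /=.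
under eq_bigr do rewrite -mulr_sumr fdist_sum1 mulr1.
by rewrite -(pair_bigA _ (fun s o => init M s * obs M s o * V (o, rm_init RM))).
Qed.

Variable q : O -> R -> O -> U -> A -> R.
Hypothesis qP : predicts M L RM pi q.

Lemma expectation_bootstrapped_returnS n :
  'E_(traj_law M pi)[bootstrapped_return n.+1]%E
  = (\sum_(s : (n.+2).-tuple (S * O * A))
      (partial_return (nth x0 s) n + discount M ^+ n
        * bellman M L RM q V (rm_at L RM (nth x0 s) n) (act_at (nth x0 s) n))
      * path_prob M pi n.+2 (nth x0 s))%:E.
Proof.
rewrite (traj_expectation M pi (@bootstrapped_return_determined n.+1)).
congr EFin; under [RHS]eq_bigr do rewrite mulrDl -mulrA.
rewrite big_split /= -mulr_sumr -(sum_bellman_step qP) mulr_sumr -big_split /=.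
apply: eq_bigr => s _; rewrite /bootstrapped_return /partial_return.
by rewrite big_nat_recr //= exprSr; ring.
Qed.

(** One coordinate more than [bootstrapped_return n] reads, so that this sum and the one for [n.+1]
    range over the same paths and compare term by term. *)
Lemma expectation_bootstrapped_return n :
  'E_(traj_law M pi)[bootstrapped_return n]%E
  = (\sum_(s : (n.+2).-tuple (S * O * A)) bootstrapped_return n (nth x0 s)
      * path_prob M pi n.+2 (nth x0 s))%:E.
Proof.
apply: traj_expectation.
exact: determined_by_first_leq (@bootstrapped_return_determined n).
Qed.

Lemma value_le_supersolution : (forall x a, bellman M L RM q V x a <= V x) ->
  (value M pi <= (\sum_s \sum_o init M s * obs M s o * V (o, rm_init RM))%:E)%E.
Proof.
move=> QV; rewrite -expectation_bootstrapped_return0.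
rewrite -(cvg_lim _ value_cvg) //; apply: lime_le; first exact: cvgP value_cvg.
(* By induction every [J n] is at most [J 0]; what remains is the one-step decrease. *)
apply: nearW; elim=> // n; apply: le_trans.
rewrite expectation_bootstrapped_returnS expectation_bootstrapped_return.
rewrite lee_fin.
apply: ler_sum => s _; rewrite ler_wpM2r ?path_prob_ge0 // lerD2l.
by rewrite ler_wpM2l ?exprn_ge0.
Qed.

Lemma value_greedy :
  (forall h a, pi h a != 0 ->
    bellman M L RM q V (last_obs h, rm_state L RM h) a
    = V (last_obs h, rm_state L RM h)) ->
  value M pi = (\sum_s \sum_o init M s * obs M s o * V (o, rm_init RM))%:E.
Proof.
move=> QV; rewrite -expectation_bootstrapped_return0 -(cvg_lim _ value_cvg) //.
have EJ n : 'E_(traj_law M pi)[bootstrapped_return n]%E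
          = 'E_(traj_law M pi)[bootstrapped_return 0]%E.
  elim: n => // n <-.
  rewrite expectation_bootstrapped_returnS expectation_bootstrapped_return.
  congr EFin; apply: eq_bigr => s _.
  have [p0|p0] := eqVneq (path_prob M pi n.+2 (nth x0 s)) 0.
    by rewrite p0 !mulr0.
  rewrite /bootstrapped_return /rm_at -last_obs_history_at QV //.
  (* A path of nonzero probability has a nonzero factor at index [n], so [pi] gives its action there
     nonzero probability. *)
  move: p0; rewrite /path_prob.
  move=> /prodf_neq0 /(_ (Ordinal (ltnW (ltnSn n.+1)))).
  by rewrite /step_prob mulf_eq0 negb_or => /(_ isT)/andP[].
by under eq_fun do rewrite EJ; exact: lim_cst.
Qed.

End value_limit.

(** * The greedy policy and the conclusion *)

(** Kept transparent so that the probabilities of the greedy policy reduce by computation. *)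
Definition fdist_dirac (R : realType) (T : finType) (x : T) : fdist R T.
Proof.
exists (fun y => (y == x)%:R) => [y|]; first exact: ler0n.
by rewrite (bigD1 x) //= eqxx big1 ?addr0 // => y /negbTE ->.
Defined.

Theorem theorem5 (R : realType) (S O A : finType) (M : pomdp R S O A)
    (gamma_range : 0 <= discount M < 1)
    (Sym : Type) (L : labelling O A Sym)
    (U : finType) (RM : reward_machine R Sym U)
    (perfect : perfect_rm M L RM)
    (pi : rm_policy R O A U) :
  optimal_rm M L RM pi -> optimal_pomdp M (execute L RM pi).
Proof.
move=> pi_opt pi'; case: perfect => q q_perfect.
(* The competing policy supplies an action, which the arg max in the Bellman solution requires. *)
pose a0 := (some_step M pi').2.
have [V [V_bounded QV greedyV]] := bellman_optimal_value L RM q gamma_range a0.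
have [d dP] := choice greedyV.
pose greedy : rm_policy R O A U := fun o u => fdist_dirac R (d (o, u)).
(* Optimality of [pi] among machine policies leaves only [pi'] to be compared with [greedy], whose
   value is exactly the common [J 0]. *)
apply: le_trans (pi_opt greedy).
rewrite (value_greedy gamma_range V_bounded (q_perfect (execute L RM greedy))).
  exact: (value_le_supersolution gamma_range V_bounded (q_perfect pi') QV).
move=> h a /=.
case: (a =P d (last_obs h, rm_state L RM h)) => [-> _|_]; first exact: dP.
by rewrite eqxx.
Qed.
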